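(* Let $\mathcal{H}$ be a $3$-uniform hypergraph with $n$ vertices and $q$ edges, $q\geq 1$. If the spectrum of $\mathcal{H}$ is $3$-symmetric, then $$EE(\mathcal{H})\leq\frac{2(\cosh\rho-1)}{3\rho}\,\mathcal{E}(\mathcal{H})+k,$$ where $\rho$ is the spectral radius of the adjacency tensor $\mathcal{A}_{\mathcal{H}}$, $\mathcal{E}(\mathcal{H})$ is the energy of $\mathcal{H}$, $EE(\mathcal{H})$ is the Estrada index of $\mathcal{H}$, and $k=2^{n-1}n$.
   Context: Write $[n]=\{1,\dots,n\}$. A hypergraph $\mathcal{H}=(V(\mathcal{H}),E(\mathcal{H}))$ (here with $V(\mathcal{H})=[n]$, and $E(\mathcal{H})$ a set of subsets of $V(\mathcal{H})$) is $m$-uniform if $|e|=m\geq 2$ for every $e\in E(\mathcal{H})$. Its adjacency tensor is the order $m$ dimension $n$ tensor $\mathcal{A}_{\mathcal{H}}=(h_{i_1\cdots i_m})_{i_1,\dots,i_m\in[n]}$ with $h_{i_1\cdots i_m}=\frac{1}{(m-1)!}$ if $\{i_1,\dots,i_m\}\in E(\mathcal{H})$ (in particular $i_1,\dots,i_m$ are distinct) and $h_{i_1\cdots i_m}=0$ otherwise. For an order $m$ dimension $n$ complex tensor $\mathcal{T}=(t_{i_1\cdots i_m})$ and $x\in\mathbb{C}^n$, let $\mathcal{T}x^{m-1}\in\mathbb{C}^n$ have $i$-th component $\sum_{i_2,\dots,i_m\in[n]}t_{ii_2\cdots i_m}x_{i_2}\cdots x_{i_m}$, and let $x^{[m-1]}=(x_1^{m-1},\dots,x_n^{m-1})^{\mathrm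 T}$. A number $\lambda\in\mathbb{C}$ is an eigenvalue of $\mathcal{T}$ if $\mathcal{T}x^{m-1}=\lambda x^{[m-1]}$ for some nonzero $x\in\mathbb{C}^n$. Eigenvalues are counted with multiplicity as roots of the characteristic polynomial of $\mathcal{T}$, i.e. the resultant of the $n$ homogeneous polynomials $\lambda x_i^{m-1}-(\mathcal{T}x^{m-1})_i$, $i\in[n]$, in $x_1,\dots,x_n$; there are $k=n(m-1)^{n-1}$ of them, $\lambda_1,\dots,\lambda_k$. Let $\lambda_1,\dots,\lambda_k$ be all the eigenvalues of $\mathcal{A}_{\mathcal{H}}$; the multiset of these is the spectrum of $\mathcal{H}$. The spectral radius is $\rho=\max_i|\lambda_i|$. The Estrada index is $EE(\mathcal{H})=\sum_{i=1}^{k}e^{\lambda_i}$ (it is a real number). The energy is $\mathcal{E}(\mathcal{H})=\sum_{j=1}^{k}|\lambda_j|$. The spectrum of an $m$-uniform hypergraph is $m$-symmetric if it (as a multiset) is invariant under rotation by the angle $2\pi/m$ in the complex plane. *)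

(* Defs.v *)
(* Mathematical Components, with MathComp-Analysis for the real numbers,
   real-closed for the complex numbers R[i] over R, and multinomials for
   multivariate polynomials. *)
From mathcomp Require Import all_boot all_order all_algebra.
From mathcomp Require Import mpoly complex.
From mathcomp Require Import reals sequences exp trigo.

Set Implicit Arguments.
Unset Strict Implicit.
Unset Printing Implicit Defensive.

Import Order.TTheory GRing.Theory Num.Theory.
Import ComplexField.Normc.

Local Open Scope ring_scope.
Local Open Scope complex_scope.

(* The resultant of n homogeneous polynomials F_i in n variables, F_i of degree
   d i > 0, as Macaulay's quotient of determinants.

   Put D = \sum_i (d i - 1) + 1.  Every monomial X^a of degree D has a least
   index i with d i <= a i; the row of the Macaulay matrix M indexed by a lists
   the coefficients of X^(a - d_i e_i) * F_i on the monomials of degree D.  Let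
   M' be the principal submatrix of M on the monomials X^a for which d i <= a i
   holds for at least two indices i.  Macaulay's theorem states that
     \det M = Res(F) * \det M'
   for polynomials with indeterminate coefficients, with the sign and scaling
   fixed by Res(X_i^(d i))_i = 1.

   To have a formula valid for all coefficients, including those for which
   \det M' = 0, F_i is replaced by F_i + t X_i^(d i) with t a new indeterminate.
   This adds t to the diagonals of M and M', so the two determinants become
   \det (t + M) = char_poly (- M) and \det (t + M') = char_poly (- M'); they are
   monic in t, their quotient is exact, and its value at t = 0 is Res(F). *)
Section Resultant.
Variables (A : comNzRingType) (n : nat).
Variables (d : 'I_n -> nat) (F : 'I_n -> {mpoly A[n]}).

Definition macaulay_degree : nat := (\sum_i (d i).-1).+1.

Definition macaulay_monomial := 'X_{1..n < macaulay_degree.+1}.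

Definition macaulay_least (a : 'X_{1..n}) (i : 'I_n) : bool :=
  (d i <= a i)%N && [forall (j : 'I_n | (j < i)%N), (a j < d j)%N].

(* For a of degree macaulay_degree the sum has exactly one term. *)
Definition macaulay_row (a : 'X_{1..n}) : {mpoly A[n]} :=
  \sum_(i | macaulay_least a i) 'X_[(a - U_(i) *+ d i)%MM] * F i.

Definition macaulay_mx (S : {set macaulay_monomial}) : 'M[A]_#|S| :=
  \matrix_(r, c)
    (macaulay_row (enum_val r : macaulay_monomial))
      @_(enum_val c : macaulay_monomial).

Definition macaulay_all : {set macaulay_monomial} :=
  [set a : macaulay_monomial | mdeg a == macaulay_degree].

Definition macaulay_nonreduced : {set macaulay_monomial} :=
  [set a in macaulay_all | (1 < #|[set i | (d i <= (a : 'X_{1..n}) i)%N]|)%N].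

Definition resultant : A :=
  (Pdiv.CommonRing.rdivp (char_poly (- macaulay_mx macaulay_all))
     (char_poly (- macaulay_mx macaulay_nonreduced))).[0].

End Resultant.

(* [T i j] is the entry t_(i, j_1, ..., j_(m-1)) of a tensor of order m > 0. *)
Definition tensor (K : Type) (m n : nat) := 'I_n -> (m.-1).-tuple 'I_n -> K.

Section Tensor.
Variables (K : comNzRingType) (m n : nat) (T : tensor K m n).

(* lambda x_i^(m-1) - (T x^(m-1))_i in x_1, ..., x_n, with lambda = 'X. *)
Definition eigen_equation (i : 'I_n) : {mpoly {poly K}[n]} :=
  'X *: 'X_i ^+ m.-1
  - \sum_(j : (m.-1).-tuple 'I_n) (T i j)%:P *: \prod_(l <- j) 'X_l.

Definition tensor_char_poly : {poly K} :=
  resultant (fun=> m.-1) eigen_equation.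

End Tensor.

Definition hypergraph (n : nat) := {set {set 'I_n}}.

Definition uniform (m n : nat) (H : hypergraph n) : bool :=
  [forall e in H, #|e| == m].

Section Complex.
Variable R : realType.

Definition expC (z : R[i]) : R[i] :=
  let: x +i* y := z in (expR x * cos y) +i* (expR x * sin y).

Definition cosh (x : R) : R := (expR x + expR (- x)) / 2.

(* For m-uniform H and m > 1, an m-tuple of vertices spanning an edge is
   automatically made of distinct vertices. *)
Definition adjacency_tensor (m n : nat) (H : hypergraph n) : tensor R[i] m n :=
  fun i j => if i |: [set x in j] \in H then ((m.-1)`!)%:R^-1 else 0.

(* The roots of the characteristic polynomial, with multiplicity. *)
Definition spectrum (m n : nat) (H : hypergraph n) : seq R[i] :=
  sval (closed_field_poly_normal (tensor_char_poly (adjacency_tensor (m := m) H))).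

Definition symmetric_spectrum (m n : nat) (H : hypergraph n) : bool :=
  perm_eq [seq expC (0 +i* (2 * pi / m%:R)) * z | z <- spectrum m H]
          (spectrum m H).

Definition spectral_radius (m n : nat) (H : hypergraph n) : R :=
  \big[Num.max/0]_(z <- spectrum m H) normc z.

Definition energy (m n : nat) (H : hypergraph n) : R :=
  \sum_(z <- spectrum m H) normc z.

Definition estrada_index (m n : nat) (H : hypergraph n) : R[i] :=
  \sum_(z <- spectrum m H) expC z.

End Complex.

(* Main.v *)
(* By symmetry, 3 EE is the sum over the spectrum of
   e^z + e^(w z) + e^(w^2 z), w = e^(2 i pi / 3).  The real parts of z, w z and
   w^2 z sum to 0 and lie in [-|z|, |z|], so Karamata's inequality bounds the real
   part of that expression by 3 + 2 (cosh |z| - 1), and by convexity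
   cosh |z| - 1 <= (|z| / rho) (cosh rho - 1).  Since the characteristic
   polynomial is real, so is EE; its degree is at most the number of monomials of
   degree n + 1 with exactly one exponent greater than 1, which is at most
   n 2^(n-1). *)
Require Import Defs.
From mathcomp Require Import all_boot all_order all_algebra.
From mathcomp Require Import mpoly complex polyXY reals sequences exp trigo.
From mathcomp Require Import ring lra.

Set Implicit Arguments.
Unset Strict Implicit.
Unset Printing Implicit Defensive.

Import Order.TTheory GRing.Theory Num.Theory.
Import ComplexField.Normc.
Import Pdiv.CommonRing Pdiv.RingMonic.

Local Open Scope ring_scope.
Local Open Scope complex_scope.

(** * Shifting the variable in an exact quotient *)

Lemma monic_poly_XaY (A : idomainType) (p : {poly A}) :
  p \is monic -> poly_XaY p \is monic.
Proof. by rewrite !monicE lead_coef_poly_XaY => /eqP ->. Qed.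

(** Substituting ['X + 'Y] is a ring morphism that preserves sizes and monicity, so it carries a
    Euclidean division by [d] to a Euclidean division. *)
Lemma rdivp_poly_XaY (A : idomainType) (p d : {poly A}) :
  d \is monic -> rdivp (poly_XaY p) (poly_XaY d) = poly_XaY (rdivp p d).
Proof.
move=> dmon; rewrite {1}(rdivp_eq dmon p).
have -> : poly_XaY (rdivp p d * d + rmodp p d) =
    poly_XaY (rdivp p d) * poly_XaY d + poly_XaY (rmodp p d).
  by rewrite /poly_XaY rmorphD rmorphM /= comp_polyD comp_polyM.
by rewrite rdivp_addl_mul_small ?monic_poly_XaY // !size_poly_XaY
  ltn_rmodp monic_neq0.
Qed.

(** With t the outer variable, both sides are the determinant of t + X - [B]. *)
Lemma char_poly_XaY (A : comNzRingType) (k : nat) (B : 'M[A]_k) :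
  char_poly (- ('X%:M - map_mx polyC B)) = poly_XaY (char_poly B).
Proof.
rewrite /poly_XaY /char_poly -!det_map_mx; congr (\det _).
apply/matrixP => i j; rewrite !mxE !rmorphB !rmorphMn /=.
rewrite !map_polyC map_polyX /= !comp_polyC comp_polyX.
by rewrite opprB (rmorphB (@polyC _)) /= rmorphMn /= opprB addrA mulrnDl.
Qed.

(** * Macaulay matrices of the eigenvalue equations *)

(** Pigeonhole: if every exponent were below [d i], the degree would be at most the sum of the
    [(d i).-1], one less than [macaulay_degree]. *)
Lemma macaulay_least_ex (n : nat) (d : 'I_n -> nat) (a : 'X_{1..n}) :
  mdeg a = macaulay_degree d -> exists i, macaulay_least d a i.
Proof.
move=> dega.
have [i di | no] := pickP (fun i => d i <= a i)%N.
  case: (@arg_minnP _ i (fun j => d j <= a j)%N (@nat_of_ord n) di) => j dj minj.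
  exists j; rewrite /macaulay_least dj; apply/forall_inP => l ltlj.
  by rewrite ltnNge; apply: contraL ltlj => /minj; rewrite -leqNgt.
suff : (mdeg a <= \sum_i (d i).-1)%N by rewrite dega ltnn.
rewrite mdegE; apply: leq_sum => i _.
by have := no i; case: (d i) => // k; rewrite leqNgt ltnS => /negbFE.
Qed.

Lemma macaulay_least_uniq (n : nat) (d : 'I_n -> nat) (a : 'X_{1..n}) i j :
  macaulay_least d a i -> macaulay_least d a j -> i = j.
Proof.
move=> /andP[di /forall_inP mini] /andP[dj /forall_inP minj].
case: (ltngtP i j) => [/minj|/mini|/val_inj //]; first by rewrite ltnNge di.
by rewrite ltnNge dj.
Qed.

Lemma macaulay_rowE (A : comNzRingType) (n : nat) (d : 'I_n -> nat)
    (F : 'I_n -> {mpoly A[n]}) (a : 'X_{1..n}) i :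
  macaulay_least d a i -> macaulay_row d F a = 'X_[(a - U_(i) *+ d i)%MM] * F i.
Proof.
move=> ai; rewrite /macaulay_row (big_pred1 i) // => j.
by apply/idP/eqP => [aj|-> //]; apply: macaulay_least_uniq aj ai.
Qed.

(* [T x^(m-1)] as a family of polynomials in [x]. *)
Definition tensor_apply (K : comNzRingType) (m n : nat) (T : tensor K m n)
    (i : 'I_n) : {mpoly K[n]} :=
  \sum_(j : (m.-1).-tuple 'I_n) T i j *: \prod_(l <- j) 'X_l.

Lemma eigen_equationE (K : comNzRingType) (m n : nat) (T : tensor K m n) i :
  eigen_equation T i =
  'X *: 'X_i ^+ m.-1 - map_mpoly polyC (tensor_apply T i).
Proof.
rewrite /eigen_equation /tensor_apply rmorph_sum /=; congr (_ - _).
apply: eq_bigr => j _; rewrite map_mpolyZ rmorph_prod /=; congr (_ *: _).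
by apply: eq_bigr => l _; rewrite map_mpolyX.
Qed.

Lemma map_tensor_apply (K K' : comNzRingType) (f : {rmorphism K -> K'})
    (m n : nat) (T : tensor K m n) i :
  map_mpoly f (tensor_apply T i) =
  tensor_apply (m := m) (fun i j => f (T i j)) i.
Proof.
rewrite /tensor_apply rmorph_sum /=.
apply: eq_bigr => j _; rewrite map_mpolyZ rmorph_prod /=; congr (_ *: _).
by apply: eq_bigr => l _; rewrite map_mpolyX.
Qed.

Lemma map_macaulay_mx (A A' : comNzRingType) (f : {rmorphism A -> A'})
    (n : nat) (d : 'I_n -> nat) (F : 'I_n -> {mpoly A[n]})
    (S : {set macaulay_monomial d}) :
  map_mx f (macaulay_mx F S) = macaulay_mx (fun i => map_mpoly f (F i)) S.
Proof.
apply/matrixP => r c; rewrite !mxE -mcoeff_map_mpoly; congr (_ @_ _).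
rewrite /macaulay_row rmorph_sum /=.
by apply: eq_bigr => i _; rewrite rmorphM /= map_mpolyX.
Qed.

Lemma eq_macaulay_mx (A : comNzRingType) (n : nat) (d : 'I_n -> nat)
    (F G : 'I_n -> {mpoly A[n]}) (S : {set macaulay_monomial d}) :
  F =1 G -> macaulay_mx F S = macaulay_mx G S.
Proof.
move=> eqFG; apply/matrixP => r c; rewrite !mxE; congr (_ @_ _).
by apply: eq_bigr => i _; rewrite eqFG.
Qed.

(** In the row of X^a, the multiplier X^(a - (m-1) e_i) turns the term in ['X_i ^+ m.-1] back into
    X^a, so the eigenvalue variable occurs only on the diagonal. *)
Lemma macaulay_mx_eigen (K : comNzRingType) (m n : nat) (T : tensor K m n)
    (S : {set macaulay_monomial (fun _ : 'I_n => m.-1)}) :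
  S \subset macaulay_all (fun=> m.-1) ->
  macaulay_mx (eigen_equation T) S =
  'X%:M - map_mx polyC (macaulay_mx (tensor_apply T) S).
Proof.
move=> /subsetP sub; apply/matrixP => r c.
have := sub _ (enum_valP r); rewrite inE => /eqP /macaulay_least_ex [i ai].
rewrite !mxE !(macaulay_rowE _ ai) eigen_equationE mulrBr mcoeffB.
rewrite -[X in _ = _ - X](mcoeff_map_mpoly (@polyC K)).
rewrite [map_mpoly _ (_ * _)]rmorphM /= map_mpolyX.
congr (_ - _); rewrite -scalerAr mcoeffZ mpolyXn -mpolyXD submK; last first.
  apply/mnm_lepP => j; rewrite mulmnE mnm1E.
  have [<-|_] := eqVneq; last by rewrite mul0n.
  by rewrite mul1n; case/andP: ai.
by rewrite mcoeffX mulr_natr (inj_eq val_inj) (inj_eq enum_val_inj).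
Qed.

Lemma macaulay_nonreduced_sub (n : nat) (d : 'I_n -> nat) :
  macaulay_nonreduced d \subset macaulay_all d.
Proof. by apply/subsetP => a; rewrite inE => /andP[]. Qed.

(* The Macaulay matrices of the eigenvalue equations are ['X - B] with [B]
   constant, so the indeterminate [t] of [resultant] enters only through
   ['X + t], and setting [t = 0] leaves a quotient of characteristic
   polynomials over the base field. *)
Lemma tensor_char_polyE (K : fieldType) (m n : nat) (T : tensor K m n) :
  tensor_char_poly T =
  char_poly (macaulay_mx (tensor_apply T) (macaulay_all (fun=> m.-1)))
  %/ char_poly (macaulay_mx (tensor_apply T) (macaulay_nonreduced (fun=> m.-1))).
Proof.
rewrite /tensor_char_poly /Defs.resultant.
rewrite !macaulay_mx_eigen ?macaulay_nonreduced_sub //.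
rewrite !char_poly_XaY rdivp_poly_XaY ?char_poly_monic //.
by rewrite horner_poly_XaY add0r comp_polyXr Pdiv.IdomainMonic.divpE ?char_poly_monic.
Qed.

(** * Degree and change of field of the characteristic polynomial *)

Lemma size_tensor_char_poly (K : fieldType) (m n : nat) (T : tensor K m n) :
  size (tensor_char_poly T) =
  #|macaulay_all (fun _ : 'I_n => m.-1) :\: macaulay_nonreduced (fun=> m.-1)|.+1.
Proof.
rewrite tensor_char_polyE size_divp ?monic_neq0 ?char_poly_monic //.
rewrite !size_char_poly subSn ?subset_leq_card ?macaulay_nonreduced_sub //.
by rewrite cardsDS ?macaulay_nonreduced_sub.
Qed.

Lemma map_tensor_char_poly (K K' : fieldType) (f : {rmorphism K -> K'})
    (m n : nat) (T : tensor K m n) :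
  map_poly f (tensor_char_poly T) =
  tensor_char_poly (m := m) (fun i j => f (T i j)).
Proof.
rewrite !tensor_char_polyE map_divp !map_char_poly !map_macaulay_mx.
by rewrite !(eq_macaulay_mx _ (map_tensor_apply f T)).
Qed.

(** A reduced monomial has exactly one exponent above [d]. Once its position is chosen, the other
    [n.-1] exponents are at most [d], and the total degree fixes the large one. *)
Lemma card_macaulay_reduced (n d : nat) :
  (#|macaulay_all (fun _ : 'I_n => d.+1) :\: macaulay_nonreduced (fun=> d.+1)|
   <= n * d.+1 ^ n.-1)%N.
Proof.
pose M := macaulay_monomial (fun _ : 'I_n => d.+1).
pose top i := [set a : M in macaulay_all (fun=> d.+1)
  | [forall j, (d < (a : 'X_{1..n}) j)%N ==> (j == i)]].
have card_top i : (#|top i| <= d.+1 ^ n.-1)%N.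
  (* [g] keeps the exponents away from [i]; the value [ord0] at [i] puts its image among the
     functions supported off [i]. *)
  pose g (a : M) := [ffun j : 'I_n =>
    if j == i then ord0 else inord ((a : 'X_{1..n}) j) : 'I_d.+1].
  have ltad (a : M) j : a \in top i -> j != i -> ((a : 'X_{1..n}) j < d.+1)%N.
    rewrite inE => /andP[_ /forallP/(_ j)/implyP imp] ji.
    by rewrite ltnS leqNgt; apply: contra ji => /imp.
  have injg : {in top i &, injective g}.
    move=> a b ai bi /ffunP eqg; apply/val_inj/mnmP.
    have eqab j : j != i -> (a : 'X_{1..n}) j = (b : 'X_{1..n}) j.
      move=> ji; have := eqg j; rewrite !ffunE (negbTE ji) => /(congr1 val).
      by rewrite /= !inordK ?ltad.
    move=> j; have [->{j}|] := eqVneq j i; last exact: eqab.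
    move: ai bi; rewrite !inE => /andP[/eqP dega _] /andP[/eqP degb _].
    have : mdeg a = mdeg b by rewrite dega degb.
    rewrite !mdegE !(bigD1 (P := predT) i) //=.
    by rewrite (eq_bigr _ eqab) => /addIn.
  rewrite -(card_in_imset injg) -[X in (X ^ _)%N]card_ord.
  have -> : n.-1 = #|predC1 i| by rewrite cardC1 card_ord.
  rewrite -(card_pffun_on ord0); apply: subset_leq_card.
  apply/subsetP => _ /imsetP[a _ ->]; apply/pffun_onP; split=> //.
  by apply/supportP => j; rewrite !inE negbK ffunE => ->.
suff sub : macaulay_all (fun=> d.+1) :\: macaulay_nonreduced (fun=> d.+1)
    \subset \bigcup_i top i.
  apply: leq_trans (subset_leq_card sub) _.
  apply: (@leq_trans (\sum_(i < n) #|top i|)).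
    apply: (big_ind2 (fun (X : {set M}) k => #|X| <= k)%N).
    - by rewrite cards0.
    - move=> X k Y l Xk Yl; apply: leq_trans (leq_card_setU _ _) _.
      exact: leq_add.
    - by [].
  rewrite -[X in (X * _)%N]card_ord -sum_nat_const.
  by apply: leq_sum => i _; apply: card_top.
apply/subsetP => a; rewrite in_setD => /andP[/[swap] alla].
rewrite inE alla /= -leqNgt => /card_le1_eqP uniq_top.
have := alla; rewrite inE => /eqP /macaulay_least_ex [i /andP[di _]].
apply/bigcupP; exists i => //; rewrite inE alla.
by apply/forallP => j; apply/implyP => dj; apply/eqP/uniq_top; rewrite inE.
Qed.

(** * Real inequalities for exp and cosh *)

Section Exponential.
Variable R : realType.
Implicit Types a b c r x : R.

(* Karamata: (r, 0, -r) majorizes (a, b, c).  With [M = e^r], [W = e^-r], the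
   inequality multiplied by [1 - W^2] is the sum of
   [W^2 (M - e^a)(M - e^b)(M - e^c) >= 0] and
   [(e^a - W)(e^b - W)(e^c - W) >= 0]. *)
Lemma sum_expR_le a b c r :
  a + b + c = 0 -> `|a| <= r -> `|b| <= r -> `|c| <= r ->
  expR a + expR b + expR c <= expR r + expR (- r) + 1.
Proof.
move=> abc0; rewrite !ler_norml => /andP[la ua] /andP[lb ub] /andP[lc uc].
(* At [r = 0] the multiplier [1 - W ^+ 2] vanishes, so this case is separate. *)
have [r0|r_gt0] := leP r 0.
  have [-> -> -> ->] : [/\ a = 0, b = 0, c = 0 & r = 0] by split; lra.
  by rewrite oppr0 expR0.
have ABC : expR a * expR b * expR c = 1 by rewrite -!expRD abc0 expR0.
have MW : expR r * expR (- r) = 1 by rewrite -expRD subrr expR0.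
have W1 : expR (- r) < 1 by rewrite expR_lt1 oppr_lt0.
move: la lb lc ua ub uc (expR_gt0 (- r)).
rewrite -(ler_expR _ a) -(ler_expR _ b) -(ler_expR _ c).
rewrite -(ler_expR a) -(ler_expR b) -(ler_expR c).
move: ABC MW W1; move: (expR a) (expR b) (expR c) (expR r) (expR (- r)).
move=> A B C M W ABC MW W1 lA lB lC uA uB uC W0.
have W2 : 0 < 1 - W ^+ 2 by rewrite subr_gt0 expr_lt1 // ltW.
rewrite -subr_ge0 -(pmulr_rge0 _ W2).
have -> : (1 - W ^+ 2) * (M + W + 1 - (A + B + C)) =
   W ^+ 2 * ((M - A) * (M - B) * (M - C)) + (A - W) * (B - W) * (C - W).
  ring: ABC MW.
apply: addr_ge0; first (apply: mulr_ge0; first exact: sqr_ge0);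
  by rewrite !mulr_ge0 ?subr_ge0.
Qed.

(* Weighted sum of the tangent-line bounds at [x] for the values at [r], [0]. *)
Lemma expR_chord x r :
  0 <= x <= r -> r * expR x <= x * expR r + (r - x).
Proof.
move=> /andP[x0 xr].
have h1 : expR x * (1 + (r - x)) <= expR r.
  have -> : expR r = expR x * expR (r - x) by rewrite -expRD addrC subrK.
  by rewrite ler_pM2l ?expR_gt0 ?expR_ge1Dx.
have h2 : expR x * (1 - x) <= 1.
  by rewrite -[leRHS]expR0 -(subrr x) expRD ler_pM2l ?expR_gt0 ?expR_ge1Dx.
have := ler_wpM2l x0 h1; have xr' : 0 <= r - x by lra.
have := ler_wpM2l xr' h2; lra.
Qed.

Lemma expRN_chord x r :
  0 <= x <= r -> r * expR (- x) <= x * expR (- r) + (r - x).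
Proof.
move=> /andP[x0 xr].
have h1 : expR (- x) * (1 + (x - r)) <= expR (- r).
  have -> : expR (- r) = expR (- x) * expR (x - r) by rewrite -expRD addKr.
  by rewrite ler_pM2l ?expR_gt0 ?expR_ge1Dx.
have h2 : expR (- x) * (1 + x) <= 1.
  by rewrite -[leRHS]expR0 -(addNr x) expRD ler_pM2l ?expR_gt0 ?expR_ge1Dx.
have := ler_wpM2l x0 h1; have xr' : 0 <= r - x by lra.
have := ler_wpM2l xr' h2; lra.
Qed.

Lemma cosh_chord x r : 0 <= x <= r -> r * (cosh x - 1) <= x * (cosh r - 1).
Proof.
by move=> xr; have := expR_chord xr; have := expRN_chord xr; rewrite /cosh; lra.
Qed.

End Exponential.

(** * Rotation by a third of a turn *)

Section CubeRoot.
Variable R : realType.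
Local Notation omega := (expC (0 +i* (2 * pi / 3%:R)) : R[i]).

(** The triple-angle formula gives 4 c^3 - 3 c = 1 for the cosine c, that is (c - 1)(2 c + 1)^2 = 0,
    and c differs from 1 by injectivity of cos on [0, pi]. *)
Lemma cos_2pi3 : cos (2 * pi / 3%:R : R) = - 2^-1.
Proof.
set t := (X in cos X).
have c1 : cos t != 1.
  have p0 := pi_gt0 R.
  rewrite -cos0; apply/eqP => /cos_inj; rewrite !in_itv /= => /(_ _ _)/eqP.
  rewrite /t; lra.
have c3 : cos (t + t + t) = 1.
  have -> : t + t + t = pi *+ 2 by rewrite /t; field.
  exact: cos2pi.
have s2 := sin2cos2 t.
move: c3; rewrite !cosD !sinD.
have -> : (cos t * cos t - sin t * sin t) * cos t -
   (sin t * cos t + cos t * sin t) * sin t =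
   cos t ^+ 3 - 3 * cos t * sin t ^+ 2 by ring.
rewrite s2 => c3.
have : (cos t - 1) * (2 * cos t + 1) ^+ 2 = 0.
  by lra.
move/eqP; rewrite mulf_eq0 subr_eq0 (negbTE c1) /= expf_eq0 /= => /eqP; lra.
Qed.

Lemma normc_omega : normc omega = 1.
Proof. by rewrite /= expR0 !mul1r cos2Dsin2 sqrtr1. Qed.

Lemma sum_omega (z : R[i]) : z + omega * z + omega * (omega * z) = 0.
Proof.
have s2 := sin2cos2 (2 * pi / 3%:R : R).
rewrite /expC expR0 !mul1r; move: s2; rewrite cos_2pi3.
move: (sin _) => s s2; case: z => x y.
(* Replacing s^2 by 3/4 in each coordinate leaves goals within reach of [lra]. *)
have ssE u : s * (s * u) = 3 / 4 * u by rewrite mulrA -expr2 s2; field.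
apply/eqP; rewrite eq_complex /=; apply/andP; split; apply/eqP.
  by have := ssE x; lra.
by have := ssE y; lra.
Qed.

Lemma Re_expC_le (z : R[i]) : complex.Re (expC z) <= expR (complex.Re z).
Proof.
case: z => x y /=; rewrite ler_piMr ?expR_ge0 //; exact: cos_le1.
Qed.

Lemma normc_ge_abs_Re (z : R[i]) : `|complex.Re z| <= normc z.
Proof.
case: z => x y /=; rewrite -sqrtr_sqr ler_wsqrtr // lerDl; exact: sqr_ge0.
Qed.

Lemma sum_Re_expC_le (z : R[i]) :
  complex.Re (expC z) + complex.Re (expC (omega * z)) +
    complex.Re (expC (omega * (omega * z))) <=
  3 + 2 * (cosh (normc z) - 1).
Proof.
have -> : 3 + 2 * (cosh (normc z) - 1) =
    expR (normc z) + expR (- normc z) + 1 by rewrite /cosh; field.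
apply: le_trans (lerD (lerD (Re_expC_le _) (Re_expC_le _)) (Re_expC_le _)) _.
have n1 : normc (omega * z) = normc z by rewrite normcM normc_omega mul1r.
have n2 : normc (omega * (omega * z)) = normc z.
  by rewrite normcM normc_omega mul1r.
apply: sum_expR_le.
- move: (sum_omega z) => {n1 n2}.
  by case: z (omega * z) (omega * (omega * z)) => ? ? [? ?] [? ?] [].
- exact: normc_ge_abs_Re.
- rewrite -n1; exact: normc_ge_abs_Re.
- rewrite -n2; exact: normc_ge_abs_Re.
Qed.

End CubeRoot.

(** * The spectrum and its conjugation symmetry *)

Section Spectrum.
Variables (R : realType) (m n : nat) (H : hypergraph n).
Local Notation p := (tensor_char_poly (adjacency_tensor R (m := m) H)).
Local Notation s := (spectrum R m H).

Lemma char_poly_spectrum : p = lead_coef p *: \prod_(z <- s) ('X - z%:P).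
Proof. by rewrite /spectrum; case: closed_field_poly_normal. Qed.

(** The size is a successor, so the polynomial is nonzero and [spectrum] really lists its roots. *)
Lemma lead_coef_adjacency_neq0 : lead_coef p != 0.
Proof. by rewrite lead_coef_eq0 -size_poly_eq0 size_tensor_char_poly. Qed.

Lemma size_spectrum : (size s).+1 = size p.
Proof.
by rewrite [in RHS]char_poly_spectrum size_scale ?lead_coef_adjacency_neq0 //
  size_prod_XsubC.
Qed.

(** The tensor entries are rational, so conjugation fixes the characteristic polynomial; unique
    factorization then permutes the roots. *)
Lemma spectrum_conj : perm_eq [seq z^* | z <- s] s.
Proof.
have conj_p : map_poly (@conjc R) p = p.
  rewrite map_tensor_char_poly; congr tensor_char_poly.
  apply: boolp.funext => i; apply: boolp.funext => j; rewrite /adjacency_tensor.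
  by case: ifP => _; rewrite ?rmorph0 // fmorphV rmorph_nat.
apply: prod_XsubC_eq; rewrite big_map.
apply: (scalerI lead_coef_adjacency_neq0); rewrite -char_poly_spectrum.
rewrite -[RHS]conj_p [in RHS]char_poly_spectrum map_polyZ -lead_coef_map conj_p /=.
rewrite rmorph_prod; congr (_ *: _); apply: eq_bigr => z _.
by rewrite rmorphB /= map_polyX map_polyC.
Qed.

Lemma estrada_index_real : complex.Im (estrada_index R m H) = 0.
Proof.
have expC_conj (z : R[i]) : expC z^* = (expC z)^*.
  by case: z => x y; rewrite /= cosN sinN mulrN.
have : (estrada_index R m H)^* = estrada_index R m H.
  rewrite /estrada_index rmorph_sum /= -[RHS](perm_big _ spectrum_conj) big_map.
  by apply: eq_bigr => z _; rewrite expC_conj.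
case: (estrada_index R m H) => x y /= [] /eqP; rewrite -subr_eq0; lra.
Qed.

Lemma normc_le_spectral_radius z : z \in s -> normc z <= spectral_radius R m H.
Proof. by move=> sz; apply: le_bigmax_seq sz _. Qed.

Lemma Re_estrada_index :
  complex.Re (estrada_index R m H) = \sum_(z <- s) complex.Re (expC z).
Proof. by apply: big_morph => // -[? ?] [? ?]. Qed.

End Spectrum.

(** * The bound on the Estrada index *)

Lemma size_spectrum3 (R : realType) (n : nat) (H : hypergraph n) :
  (size (spectrum R 3 H) <= 2 ^ n.-1 * n)%N.
Proof.
by rewrite -ltnS size_spectrum size_tensor_char_poly ltnS mulnC
  card_macaulay_reduced.
Qed.

(* The inequality is that of R[i]: it also states that the left-hand side is
   real. *)
Theorem theorem3p2 (R : realType) (n q : nat) (H : hypergraph n) :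
  uniform 3 H -> #|H| = q -> (1 <= q)%N ->
  symmetric_spectrum R 3 H ->
  let rho := spectral_radius R 3 H in
  let k := (2 ^ n.-1 * n)%N in
  estrada_index R 3 H
    <= (2 * (cosh rho - 1) / (3 * rho) * energy R 3 H + k%:R)%:C.
Proof.
move=> _ _ _ sym; cbv zeta.
set rho := spectral_radius R 3 H; set k := (2 ^ n.-1 * n)%N.
(* The order of [R[i]] demands equal imaginary parts; only real parts remain to compare. *)
rewrite lecE estrada_index_real eqxx /= Re_estrada_index.
set s := spectrum R 3 H.
pose omega : R[i] := expC (0 +i* (2 * pi / 3%:R)).
have rot (f : R[i] -> R) : \sum_(z <- s) f (omega * z) = \sum_(z <- s) f z.
  by rewrite -[RHS](perm_big _ sym) big_map.
set S := (X in X <= _).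
have S3 : 3 * S = \sum_(z <- s) (complex.Re (expC z) + complex.Re (expC (omega * z))
    + complex.Re (expC (omega * (omega * z)))).
  rewrite !big_split /= (rot (fun z => complex.Re (expC (omega * z)))).
  rewrite (rot (fun z => complex.Re (expC z))) -/S; ring.
(* The slope of the chord of cosh between 0 and [rho]. *)
pose C := (cosh rho - 1) / rho.
have chord z : z \in s -> cosh (normc z) - 1 <= C * normc z.
  move=> sz; have zr := normc_le_spectral_radius sz.
  have z0 : 0 <= normc z by apply: le_trans (normr_ge0 _) (normc_ge_abs_Re z).
  (* Here every eigenvalue is zero, so both sides vanish whatever division by zero makes of [C]. *)
  have [r0|r_gt0] := leP rho 0.
    have -> : normc z = 0 by apply/le_anti; rewrite z0 andbT (le_trans zr).
    by rewrite mulr0 /cosh oppr0 expR0; lra.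
  rewrite /C mulrAC ler_pdivlMr // mulrC [leRHS]mulrC cosh_chord //.
  by rewrite z0.
have bound : 3 * S <= 3 * k%:R + 2 * C * energy R 3 H.
  apply: (@le_trans _ _ (\sum_(z <- s) (3 + 2 * C * normc z))).
    rewrite S3 !big_seq; apply: ler_sum => z sz.
    apply: le_trans (sum_Re_expC_le z) _.
    by have := chord z sz; lra.
  rewrite big_split /= -mulr_sumr lerD2r big_const_seq count_predT.
  rewrite iter_addr_0 -[3 *+ _]mulr_natr ler_pM2l // ler_nat.
  exact: size_spectrum3.
have -> : 2 * (cosh rho - 1) / (3 * rho) = 3^-1 * (2 * C).
  by rewrite /C invfM; ring.
lra.
Qed.
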